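(* Let $\mathbb{F}_q$ be a finite field, let $r,s\ge1$ be integers with $rs$ even, and let $\mathcal{A}=\{\alpha_1,\ldots,\alpha_r\}\subseteq\mathbb{F}_q$ be a set of $r$ pairwise distinct evaluation points. Let $V=(v_{i,j})\in(\mathbb{F}_q^\ast)^{s\times r}$ be a multiplier matrix. Assume that there exist $\lambda_1,\ldots,\lambda_r\in\mathbb{F}_q^\ast$ such that \[ v_{t+1,j}v_{s-t,j}=\lambda_j,\qquad 0\le t\le s-1,\quad 1\le j\le r. \] Then the HRS code $C=\operatorname{HRS}_{\frac{rs}{2}}(\mathcal{A},V,s,r)$ is reverse self-dual if and only if \[ \binom{m+s-1}{s-1}\sum_{j=1}^r\lambda_j\alpha_j^m=0,\qquad\text{for all } 0\le m\le rs-s-1, \] where the binomial coefficient is viewed as an element of $\mathbb{F}_q$.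
   Context: For an integer $h\ge 0$, $\mathcal{P}_{<h}=\{f\in\mathbb{F}_q[x]:\deg f<h\}$. Convention: $\alpha^0=1$ for all $\alpha$, including $\alpha=0$. Hasse derivative: for $f(x)=\sum_\ell f_\ell x^\ell\in\mathbb{F}_q[x]$ and $j\ge0$, $\partial^{(j)}f(x)=\sum_{\ell}\binom{\ell}{j}f_\ell x^{\ell-j}$ (with $\binom{\ell}{j}=0$ if $j>\ell$, binomials reduced modulo the characteristic). Hyperderivative Reed–Solomon (HRS) code: for $0\le k\le rs$, \[ \operatorname{HRS}_k(\mathcal{A},V,s,r)=\left\{\bigl(v_{i,j}\,\partial^{(i-1)}f(\alpha_j)\bigr)_{1\le i\le s,\,1\le j\le r}: f\in\mathcal{P}_{<k}\right\}\subseteq\operatorname{Mat}_{s\times r}(\mathbb{F}_q). \] Reverse bilinear form on $\operatorname{Mat}_{s\times r}(\mathbb{F}_q)$: $[A,B]_{\rm rev}=\sum_{j=1}^r\sum_{i=1}^s a_{i,j}b_{s-i+1,j}$. The reverse dual of a linear code $C$ is $C^{\perp_{\rm rev}}=\{B:[A,B]_{\rm rev}=0\text{ for all }A\in C\}$, and $C$ is reverse self-dual if $C=C^{\perp_{\rm rev}}$. *)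

(* Defs.v *)
From mathcomp Require Import all_boot all_order all_algebra.

Set Implicit Arguments.
Unset Strict Implicit.
Unset Printing Implicit Defensive.

Import GRing.Theory.
Local Open Scope ring_scope.

(* Rows and columns are numbered from 0, so the row of order i carries the i-th
   Hasse derivative f^`N(i), whose l-th coefficient is 'C(i + l, i) f_(i + l). *)
Definition hrs_word (F : finFieldType) (s r : nat) (alpha : 'I_r -> F)
    (V : 'M[F]_(s, r)) (f : {poly F}) : 'M[F]_(s, r) :=
  \matrix_(i < s, j < r) (V i j * (f^`N(i)).[alpha j]).

(* {poly_k F} is the finite type of polynomials of degree < k. *)
Definition HRS (F : finFieldType) (s r k : nat) (alpha : 'I_r -> F)
    (V : 'M[F]_(s, r)) : {set 'M[F]_(s, r)} :=
  [set hrs_word alpha V (val f) | f : {poly_k F}].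

Definition rev_form (F : finFieldType) (s r : nat) (A B : 'M[F]_(s, r)) : F :=
  \sum_(j < r) \sum_(i < s) A i j * B (rev_ord i) j.

Definition rev_dual (F : finFieldType) (s r : nat) (C : {set 'M[F]_(s, r)}) :
    {set 'M[F]_(s, r)} :=
  [set B | [forall A in C, rev_form A B == 0]].

Definition rev_self_dual (F : finFieldType) (s r : nat)
    (C : {set 'M[F]_(s, r)}) : Prop :=
  C = rev_dual C.

(* Main.v *)
(** The Leibniz rule for Hasse derivatives turns the reverse form of the words
    of [f] and [g] into [L (f * g)], where [L] is [hasse_sum].  So [C] is
    isotropic iff [L] kills ['X^l] for all [l <= rs - 2], which is the stated
    condition with [m = l - s + 1].  For maximality, Hermite interpolation makes
    every matrix the word of a unique polynomial [g] of degree [< rs].  If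
    [deg g >= rs/2] and the word of [g] is orthogonal to [C], pairing it with
    ['X^(rs - 1 - deg g)] gives [L 'X^(rs - 1) = 0]; then [L] vanishes in all
    degrees [< rs], contradicting interpolation. *)

Require Import Defs.
From mathcomp Require Import all_boot all_order all_algebra.
From mathcomp Require Import zify.

Set Implicit Arguments.
Unset Strict Implicit.
Unset Printing Implicit Defensive.

Import GRing.Theory.
Local Open Scope ring_scope.

(** Taylor expansion at [a]. It turns statements about Hasse derivatives at [a] into statements
    about coefficients, in every characteristic. *)
Lemma coef_comp_polyXaddC (R : comNzRingType) (p : {poly R}) (a : R) (n : nat) :
  (p \Po ('X + a%:P))`_n = p^`N(n).[a].
Proof.
have -> : p \Po ('X + a%:P) = \poly_(i < size p) p^`N(i).[a].
  rewrite /comp_poly addrC (nderiv_taylor_wide (n := size p)) ?size_map_polyC //;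
    last exact: mulrC.
  rewrite poly_def; apply: eq_bigr => i _.
  by rewrite nderivn_map horner_map /= mul_polyC.
by rewrite coef_poly; case: ltnP => // /nderivn_poly0 ->; rewrite horner0.
Qed.

(** Translation by [a] is multiplicative, so the Leibniz rule is the coefficient formula for a
    product; Hasse derivatives leave no binomial factors. *)
Lemma horner_nderivnM (R : comNzRingType) (p q : {poly R}) (a : R) (n : nat) :
  (p * q)^`N(n).[a] = \sum_(i < n.+1) p^`N(i).[a] * q^`N(n - i).[a].
Proof.
rewrite -coef_comp_polyXaddC comp_polyM coefM.
by apply: eq_bigr => i _; rewrite !coef_comp_polyXaddC.
Qed.

(** After translating [a] to 0, the first [n] coefficients vanish, so ['X^n] divides. *)
Lemma dvdp_XsubC_exp (F : fieldType) (p : {poly F}) (a : F) (n : nat) :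
  (forall i, (i < n)%N -> p^`N(i).[a] = 0) -> ('X - a%:P) ^+ n %| p.
Proof.
move=> p0; rewrite -(comp_polyXaddC_K p a).
have /dvdpP[q ->] : 'X^n %| p \Po ('X + a%:P).
  rewrite -(poly_take_drop n (p \Po _)) dvdp_addl ?dvdp_mull //.
  suff -> : take_poly n (p \Po ('X + a%:P)) = 0 by rewrite dvdp0.
  apply/polyP => i; rewrite coef_take_poly coef0.
  by case: ifP => // /p0; rewrite coef_comp_polyXaddC.
by rewrite comp_polyM comp_Xn_poly dvdp_mull.
Qed.

Lemma prod_coprimep_dvdp (F : fieldType) (I : eqType) (t : seq I)
    (q : I -> {poly F}) (p : {poly F}) :
    uniq t -> (forall i, q i %| p) ->
    (forall i j, i != j -> coprimep (q i) (q j)) ->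
  \prod_(i <- t) q i %| p.
Proof.
move=> t_uniq qp q_cop; elim: t t_uniq => [|i t IHt] /=.
  by rewrite big_nil dvd1p.
case/andP=> it /IHt {}IHt; rewrite big_cons Gauss_dvdp ?qp //.
rewrite big_seq; apply: (big_ind (coprimep (q i))) => [|u v iu iv|j jt].
- exact: coprimep1.
- by rewrite coprimepMr iu.
- by apply: q_cop; apply: contraNneq it => ->.
Qed.

(** The pairwise coprime powers [('X - alpha j) ^+ s] all divide [f], and their product has degree
    [r * s], too large for a nonzero [f]. *)
Lemma hermite_eq0 (F : fieldType) (r s : nat) (alpha : 'I_r -> F)
    (f : {poly F}) :
    injective alpha -> (size f <= r * s)%N ->
    (forall i j, (i < s)%N -> f^`N(i).[alpha j] = 0) ->
  f = 0.
Proof.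
move=> alpha_inj fs f0; apply/eqP; apply: contraTT fs => f_neq0.
have /(dvdp_leq f_neq0) : \prod_(j < r) ('X - (alpha j)%:P) ^+ s %| f.
  apply: prod_coprimep_dvdp => [|j|i j ij]; first exact: index_enum_uniq.
    by apply: dvdp_XsubC_exp => i /f0.
  rewrite coprimep_expl // coprimep_expr // coprimep_XsubC root_XsubC.
  by rewrite (inj_eq alpha_inj) eq_sym.
rewrite prodrXl polySpred; last first.
  by rewrite expf_neq0 // monic_neq0 // monic_prod_XsubC.
by rewrite size_exp size_prod_XsubC -[index_enum _]enumT size_enum_ord -ltnNge.
Qed.

(** By counting: the word map is injective on polynomials of size at most [r * s], and there are as
    many of these as matrices. *)
Lemma hrs_word_surj (F : finFieldType) (r s : nat) (alpha : 'I_r -> F)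
    (V : 'M[F]_(s, r)) (M : 'M[F]_(s, r)) :
    injective alpha -> (forall i j, V i j != 0) ->
  exists2 f : {poly F}, (size f <= r * s)%N & hrs_word alpha V f = M.
Proof.
move=> alpha_inj V_neq0.
pose word (f : {poly_(r * s) F}) := hrs_word alpha V (val f).
have word_inj : injective word.
  move=> f g /matrixP fg; apply/val_inj/eqP; rewrite -subr_eq0; apply/eqP.
  apply: (hermite_eq0 (s := s) alpha_inj) => [|i j i_lt_s].
    by rewrite (leq_trans (size_polyD _ _)) // size_polyN geq_max !size_npoly.
  have := fg (Ordinal i_lt_s) j; rewrite !mxE /= => /(mulfI (V_neq0 _ _)) fgij.
  by rewrite linearB !hornerE fgij subrr.
have [|g _ gK] := inj_card_bij word_inj.
  by rewrite card_npoly card_mx mulnC.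
by exists (val (g M)); [exact: size_npoly | exact: gK].
Qed.

Definition hasse_sum (F : fieldType) (r s : nat) (alpha lambda : 'I_r -> F)
    (h : {poly F}) : F :=
  \sum_(j < r) lambda j * h^`N(s.-1).[alpha j].

(** Row [i] meets row [s - 1 - i]: the multipliers collapse to [lambda j], and the orders add up to
    [s - 1], as in the Leibniz rule. *)
Lemma rev_form_hrs_word (F : finFieldType) (r s : nat)
    (alpha lambda : 'I_r -> F) (V : 'M[F]_(s, r)) (f g : {poly F}) :
    (forall t j, V t j * V (rev_ord t) j = lambda j) ->
    (0 < s)%N ->
  rev_form (hrs_word alpha V f) (hrs_word alpha V g) =
    hasse_sum s alpha lambda (f * g).
Proof.
case: s V => // s V V_lambda _; apply: eq_bigr => j _.
rewrite horner_nderivnM mulr_sumr; apply: eq_bigr => i _.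
by rewrite !mxE mulrACA V_lambda /= subSS.
Qed.

Lemma hasse_sum_coef (F : fieldType) (r s : nat) (alpha lambda : 'I_r -> F)
    (h : {poly F}) (n : nat) : (size h <= n)%N ->
  hasse_sum s alpha lambda h =
    \sum_(l < n) h`_l * hasse_sum s alpha lambda 'X^l.
Proof.
move=> hn; under [RHS]eq_bigr do rewrite mulr_sumr.
rewrite exchange_big; apply: eq_bigr => j _ /=.
rewrite {1}(_ : h = \sum_(l < n) h`_l *: 'X^l); last first.
  rewrite -poly_def; apply/polyP => i; rewrite coef_poly.
  by case: ltnP => // ni; rewrite nth_default // (leq_trans hn).
rewrite linear_sum horner_sum mulr_sumr; apply: eq_bigr => l _.
by rewrite linearZ hornerZ mulrCA.
Qed.

Lemma hasse_sumXn (F : fieldType) (r s : nat) (alpha lambda : 'I_r -> F)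
    (l : nat) :
  hasse_sum s alpha lambda 'X^l =
    'C(l, s.-1)%:R * \sum_(j < r) lambda j * alpha j ^+ (l - s.-1).
Proof.
rewrite mulr_sumr; apply: eq_bigr => j _.
by rewrite nderivnXn hornerMn hornerXn mulrCA mulr_natl.
Qed.

Lemma hasse_sum_neq0 (F : finFieldType) (r s : nat)
    (alpha lambda : 'I_r -> F) :
    injective alpha -> (forall j, lambda j != 0) -> (0 < r)%N -> (0 < s)%N ->
  exists2 h : {poly F}, (size h <= r * s)%N &
    hasse_sum s alpha lambda h != 0.
Proof.
case: r s alpha lambda => // r [] // s alpha lambda alpha_inj lambda_neq0 _ _.
(* Interpolate a single nonzero derivative, of order [s - 1] at the first point. Unit multipliers
   make the word entries bare derivatives, so the sum reduces to [lambda ord0]. *)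
have [|h hs hE] := hrs_word_surj (V := const_mx 1)
    (delta_mx (ord_max : 'I_s.+1) ord0) alpha_inj.
  by move=> i j; rewrite mxE oner_neq0.
exists h => //; rewrite /hasse_sum (bigD1 ord0) //= big1 => [|j j_neq0].
  have /matrixP/(_ ord_max ord0) := hE.
  by rewrite !mxE !eqxx mul1r => ->; rewrite mulr1 addr0.
have /matrixP/(_ ord_max j) := hE.
by rewrite !mxE (negPf j_neq0) andbF mul1r => ->; rewrite mulr0.
Qed.

Lemma mem_HRS (F : finFieldType) (s r k : nat) (alpha : 'I_r -> F)
    (V : 'M[F]_(s, r)) (f : {poly F}) :
  (size f <= k)%N -> hrs_word alpha V f \in HRS k alpha V.
Proof.
by move=> fk; apply/imsetP; exists (npolyp k f); rewrite // [val _]npolypK.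
Qed.

Theorem theorem16 (F : finFieldType) (r s : nat)
    (r_ge1 : (1 <= r)%N) (s_ge1 : (1 <= s)%N) (rs_even : ~~ odd (r * s))
    (alpha : 'I_r -> F) (alpha_inj : injective alpha)
    (V : 'M[F]_(s, r)) (V_neq0 : forall i j, V i j != 0)
    (lambda : 'I_r -> F) (lambda_neq0 : forall j, lambda j != 0)
    (V_lambda : forall (t : 'I_s) (j : 'I_r),
       V t j * V (rev_ord t) j = lambda j) :
  rev_self_dual (HRS (r * s)./2 alpha V) <->
  (forall m : nat, (m < r * s - s)%N ->
     'C(m + s - 1, s - 1)%:R * (\sum_(j < r) lambda j * alpha j ^+ m) = 0).
Proof.
set k := (r * s)./2; set L := hasse_sum s alpha lambda.
have rsE : (r * s = k + k)%N by rewrite addnn even_halfK.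
have k_gt0 : (0 < k)%N by rewrite -double_gt0 -addnn -rsE muln_gt0 r_ge1.
have formE f g : rev_form (hrs_word alpha V f) (hrs_word alpha V g) = L (f * g).
  exact: rev_form_hrs_word.
split=> [C_dual m m_lt|cond].
  pose l := (m + s - 1)%N.
  have l_lt : (l < (k + k).-1)%N by rewrite /l; lia.
  suff : L 'X^l = 0 by rewrite /L hasse_sumXn -subn1 /l -addnBA ?addnK.
  (* Since [l <= 2k - 2], ['X^l] splits into two monomials of degree at most [k - 1], whose words
     both lie in the code. *)
  have : hrs_word alpha V 'X^(l - minn l k.-1) \in rev_dual (HRS k alpha V).
    by rewrite -C_dual mem_HRS // size_polyXn; lia.
  rewrite inE => /forall_inP/(_ (hrs_word alpha V 'X^(minn l k.-1))).
  rewrite formE -exprD subnKC ?geq_minl // => lX; apply/eqP/lX.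
  by rewrite mem_HRS // size_polyXn; lia.
(* Below degree [s - 1] the binomial coefficient is already zero; from there on, [cond] applies with
   [m = l - (s - 1)]. *)
have LX0 l : (l < (r * s).-1)%N -> L 'X^l = 0.
  move=> l_lt; rewrite /L hasse_sumXn; have [ls|sl] := ltnP l s.-1.
    by rewrite bin_small ?mul0r.
  have -> : l = (l - s.-1 + s - 1)%N by lia.
  rewrite -addnBA // -subn1 addnK addnBA //; apply: cond; lia.
have L_lead (h : {poly F}) :
    size h = (r * s)%N -> L h = lead_coef h * L 'X^((r * s).-1).
  move=> hs; rewrite /L (hasse_sum_coef _ _ _ (n := (r * s).-1.+1)); last first.
    by rewrite hs leqSpred.
  rewrite big_ord_recr /= big1 ?add0r => [|l _]; first by rewrite lead_coefE hs.
  by rewrite [hasse_sum _ _ _ _]LX0 ?mulr0.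
apply/setP/subset_eqP/andP; split; apply/subsetP => B.
  case/imsetP=> f _ ->; rewrite inE; apply/forall_inP => _ /imsetP[g _ ->].
  rewrite formE /L (hasse_sum_coef _ _ _ (n := (r * s).-1)).
    by rewrite big1 // => l _; rewrite [hasse_sum _ _ _ _]LX0 ?mulr0.
  (* Two factors of size at most [k] have a product of size at most [2k - 1], so degree [r * s - 1]
     is never reached. *)
  apply: leq_trans (size_polyMleq _ _) _.
  by rewrite rsE -!subn1 leq_sub2r // leq_add // size_npoly.
have [g gs <-] := hrs_word_surj B alpha_inj V_neq0.
rewrite inE => /forall_inP gB; apply: mem_HRS; rewrite leqNgt.
apply/negP => g_gt.
have g_neq0 : g != 0 by rewrite -size_poly_gt0 (leq_trans _ g_gt).
(* This exponent lifts [g] to degree exactly [r * s - 1]; it is less than [k] because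
   [size g > k]. *)
have /gB : hrs_word alpha V 'X^(r * s - size g) \in HRS k alpha V.
  by rewrite mem_HRS // size_polyXn; lia.
rewrite formE L_lead; last first.
  by rewrite mulrC size_mulXn // subnK.
rewrite lead_coefM lead_coefXn mul1r mulf_eq0 lead_coef_eq0 (negPf g_neq0) /=.
move=> /eqP LX.
have [h hs /negP[]] := hasse_sum_neq0 alpha_inj lambda_neq0 r_ge1 s_ge1.
rewrite (hasse_sum_coef _ _ _ hs) big1 // => l _.
have [/LX0|] := ltnP l (r * s).-1; first by rewrite /L => ->; rewrite mulr0.
move=> l_ge; have -> : nat_of_ord l = (r * s).-1 by have := ltn_ord l; lia.
by rewrite [hasse_sum _ _ _ _]LX mulr0.
Qed.
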